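(* For every irrational $\theta\in(0,1)$, $$\dim_H\mathcal U_1[\theta]\ge\frac{1}{w(\theta)+1},$$ with the convention $1/(\infty+1)=0$.
   Context: $\mathbb T=\mathbb R/\mathbb Z$; points identified with fractional parts. $\|t\|$ is the distance from $t$ to the nearest integer. $w(\theta)=\sup\{s>0:\liminf_{j\to\infty}j^s\|j\theta\|=0\}$. $\mathcal U_1[\theta]$ is the set of $y\in\mathbb T$ such that there exists $Q_0$ with: for every real $Q\ge Q_0$ there is an integer $1\le n\le Q$ with $\|n\theta-y\|<Q^{-1}$. *)

(* Defs.v *)
From Stdlib Require Import Reals Lra ZArith.
Open Scope R_scope.

Definition frac (t : R) : R := t - IZR (Int_part t).
Definition distZ (t : R) : R := Rmin (frac t) (1 - frac t).

(* Points of T = R/Z are represented by their fractional parts y in [0,1). *)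

Definition U1 (theta : R) (y : R) : Prop :=
  0 <= y < 1 /\
  exists Q0 : R, forall Q : R, Q >= Q0 ->
    exists n : nat, (1 <= n)%nat /\ INR n <= Q /\
      distZ (INR n * theta - y) < / Q.

(* liminf_{j->oo} j^s ||j theta|| = 0  (all terms are >= 0) *)
Definition liminf_zero (theta s : R) : Prop :=
  forall eps : R, eps > 0 -> forall N : nat, exists j : nat,
    (N <= j)%nat /\ (1 <= j)%nat /\ Rpower (INR j) s * distZ (INR j * theta) < eps.

(* The set whose supremum is w(theta). w(theta) = +oo iff this set is unbounded. *)
Definition w_set (theta : R) (s : R) : Prop := s > 0 /\ liminf_zero theta s.

(* Hausdorff s-measure (w.r.t. the metric ||x - y|| of T) of E is zero, s > 0:
   H^s(E) = lim_{delta->0} H^s_delta(E) = 0, i.e. for every delta > 0 and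
   eps > 0 there is a countable cover of E by sets U_i of diameter <= r_i <= delta
   with sum_i r_i^s <= eps. *)
Definition H_null (s : R) (E : R -> Prop) : Prop :=
  forall delta eps : R, delta > 0 -> eps > 0 ->
    exists (U : nat -> R -> Prop) (r : nat -> R),
      (forall i, 0 < r i <= delta) /\
      (forall i x y, U i x -> U i y -> distZ (x - y) <= r i) /\
      (forall x, E x -> exists i, U i x) /\
      (forall N, sum_f_R0 (fun i => Rpower (r i) s) N <= eps).

Definition is_hausdorff_dim (E : R -> Prop) (d : R) : Prop :=
  (forall s, s > 0 -> H_null s E -> d <= s) /\
  (forall d', (forall s, s > 0 -> H_null s E -> d' <= s) -> d' <= d).

(* Main.v *)
(** Let q_k be the denominators of the convergents of [theta] and a_k its partial quotients.
    Points of the form n theta + b (q_k theta - p_k) + (smaller terms), with n < q_k and a digit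
    b of size at most sqrt(a_(k+1)), are uniformly approximated for all Q between q_k and
    q_(k+1): n, n + q_k, ..., n + b q_k come close to the point quickly enough, since
    (j + 1)(b - j) <= a_(k+1) for all j <= b.  Allowing these digits at every k gives a Cantor
    set inside U_1 with at least c sqrt(q_k) cylinders of generation k, whose centres n theta
    are 1/(2 q_k)-separated.  Hence a set of diameter r meets a proportion
    O(min(q_k^(-1/2), r q_(k+1)^(1/2))) of the cylinders when q_k <= 1/r < q_(k+1), and this is
    O(r^s) for s = 1/(w+1) as soon as q_(k+1) = O(q_k^w).

    Since sqrt(q_k) must be reached without losing a constant factor at each step, small
    partial quotients need care: a partial quotient 1 never forms a step on its own,
    and the approximating integers are sometimes taken on both sides of the point. *)

Require Import Defs.
From Stdlib Require Import Reals ZArith Lra Lia Psatz List FinFun ClassicalEpsilon.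
Open Scope R_scope.

(** * Distance to the nearest integer, nested intervals and finite sums *)

Lemma distZ_le (x : R) (p : Z) : distZ x <= Rabs (x - IZR p).
Proof.
  unfold distZ, frac. destruct (base_Int_part x) as [H1 H2].
  destruct (Z_le_gt_dec p (Int_part x)) as [H|H].
  - apply IZR_le in H. rewrite Rabs_pos_eq by lra.
    apply Rle_trans with (1 := Rmin_l _ _); lra.
  - assert (H' : (Int_part x + 1 <= p)%Z) by lia.
    apply IZR_le in H'. rewrite plus_IZR in H'.
    rewrite Rabs_left1 by lra.
    apply Rle_trans with (1 := Rmin_r _ _); lra.
Qed.

Lemma distZ_attained (x : R) : exists p : Z, distZ x = Rabs (x - IZR p).
Proof.
  unfold distZ, frac. destruct (base_Int_part x) as [H1 H2].
  destruct (Rle_dec (x - IZR (Int_part x)) (1 - (x - IZR (Int_part x)))) as [H|H].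
  - exists (Int_part x). rewrite Rmin_left by lra. rewrite Rabs_pos_eq; lra.
  - exists (Int_part x + 1)%Z. rewrite Rmin_right by lra.
    rewrite plus_IZR, Rabs_left1; lra.
Qed.

Lemma sign_cases (k : nat) : (-1) ^ k = 1 \/ (-1) ^ k = -1.
Proof. induction k as [|k IH]; simpl; lra. Qed.

Lemma nested_intervals (lo hi : nat -> R) :
  (forall j, lo j <= hi j) -> (forall j, lo j <= lo (S j)) -> (forall j, hi (S j) <= hi j) ->
  exists y, forall j, lo j <= y <= hi j.
Proof.
  intros Hlh Hlo Hhi.
  assert (Hlo' : forall i n, lo i <= lo (i + n)%nat).
  { intros i n. induction n as [|n IH]; [rewrite Nat.add_0_r; lra|].
    rewrite Nat.add_succ_r. specialize (Hlo (i + n)%nat). lra. }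
  assert (Hhi' : forall i n, hi (i + n)%nat <= hi i).
  { intros i n. induction n as [|n IH]; [rewrite Nat.add_0_r; lra|].
    rewrite Nat.add_succ_r. specialize (Hhi (i + n)%nat). lra. }
  assert (Hcross : forall i j, lo i <= hi j).
  { intros i j. specialize (Hlo' i j). specialize (Hhi' j i).
    rewrite (Nat.add_comm j i) in Hhi'. specialize (Hlh (i + j)%nat). lra. }
  destruct (completeness (fun x => exists j, x = lo j)) as [y [Hub Hlub]].
  - exists (hi 0%nat). intros x [j ->]. apply Hcross.
  - now exists (lo 0%nat), 0%nat.
  - exists y. intros j. split; [apply Hub; now exists j|].
    apply Hlub. intros x [i ->]. apply Hcross.
Qed.

Lemma ln_monotone (x y : R) : 0 < x -> x <= y -> ln x <= ln y.
Proof.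
  intros Hx [H| ->]; [|lra]. now apply Rlt_le, ln_increasing.
Qed.

Lemma exp_monotone (x y : R) : x <= y -> exp x <= exp y.
Proof. intros [H| ->]; [|lra]. now apply Rlt_le, exp_increasing. Qed.

Lemma NoDup_flat_map {A B : Type} (f : A -> list B) (l : list A) :
  NoDup l -> (forall a, In a l -> NoDup (f a)) ->
  (forall a a' b, In a l -> In a' l -> In b (f a) -> In b (f a') -> a = a') ->
  NoDup (flat_map f l).
Proof.
  induction l as [|a l IH]; simpl; intros Hl Hf Hd; [constructor|].
  inversion Hl; subst. apply NoDup_app; [auto|apply IH; eauto|].
  intros b Hb Hb'. apply in_flat_map in Hb'. destruct Hb' as (a' & Ha' & Hb').
  assert (a = a') by eauto. congruence.
Qed.

Definition rsum {A : Type} (f : A -> R) (l : list A) : R :=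
  fold_right (fun a s => f a + s) 0 l.

Lemma rsum_sum_f_R0 {A : Type} (f : nat -> A -> R) (l : list A) (K : nat) :
  rsum (fun a => sum_f_R0 (fun i => f i a) K) l = sum_f_R0 (fun i => rsum (f i) l) K.
Proof.
  induction l as [|a l IH]; simpl.
  - induction K as [|K IHK]; simpl; [|rewrite <- IHK]; ring.
  - rewrite IH. rewrite <- plus_sum. reflexivity.
Qed.

Lemma sum_f_R0_mono (f : nat -> R) (K K' : nat) : (forall i, 0 <= f i) -> (K <= K')%nat ->
  sum_f_R0 f K <= sum_f_R0 f K'.
Proof.
  intros Hf. induction 1 as [|K' H IH]; simpl; [lra|]. specialize (Hf (S K')). lra.
Qed.

(** If every entry eventually exceeded [x], monotonicity would give one [K] at which all of them do,
    and the sum at that [K] would beat the average. So one entry serves every [K]. *)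
Lemma monotone_pigeonhole {A : Type} (W : A -> nat -> R) (x : R) (l : list A) : l <> nil ->
  (forall a K K', (K <= K')%nat -> W a K <= W a K') ->
  (forall K, rsum (fun a => W a K) l <= INR (length l) * x) ->
  exists a, In a l /\ forall K, W a K <= x.
Proof.
  intros Hl Hmono Hsum. apply NNPP. intros Hno.
  assert (H : forall a, In a l -> exists K, x < W a K).
  { intros a Ha. apply NNPP. intros H. apply Hno. exists a. split; [assumption|].
    intros K. apply Rnot_lt_le. intros H'. apply H. now exists K. }
  assert (G : exists K, forall a, In a l -> x < W a K).
  { clear Hl Hsum Hno. induction l as [|a l IH]; [exists 0%nat; intros a []|].
    destruct IH as [K HK]; [intros; apply H; now right|].
    destruct (H a (or_introl eq_refl)) as [K' HK'].
    exists (max K K'). intros a' [<-|Ha'].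
    - apply Rlt_le_trans with (1 := HK'), Hmono. lia.
    - apply Rlt_le_trans with (1 := HK a' Ha'), Hmono. lia. }
  destruct G as [K HK]. specialize (Hsum K).
  assert (G : INR (length l) * x < rsum (fun a => W a K) l); [|lra].
  clear - Hl HK. destruct l as [|a l]; [congruence|]. clear Hl.
  revert a HK. induction l as [|b l IH]; intros a HK.
  - simpl. specialize (HK a (or_introl eq_refl)). lra.
  - specialize (IH b ltac:(intros; apply HK; now right)).
    specialize (HK a (or_introl eq_refl)).
    replace (INR (length (a :: b :: l))) with (INR (length (b :: l)) + 1)
      by (rewrite <- S_INR; reflexivity).
    change (rsum (fun a => W a K) (a :: b :: l)) with (W a K + rsum (fun a => W a K) (b :: l)).
    lra.
Qed.

(** * Homogeneous trees of integers *)

Section Tree.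

Context (m : nat -> nat) (inc : nat -> nat -> nat).

(** A node is encoded by its integer alone; [f] is the number of generations to descend. Arity and
    increments depend only on the level, so all nodes of a generation carry equal weight. *)
Fixpoint desc (f j n : nat) : list nat :=
  match f with
  | O => n :: nil
  | S f => flat_map (fun c => desc f (S j) (n + inc j c)) (seq 0 (m j))
  end.

Fixpoint width (j : nat) : nat :=
  match j with O => 1%nat | S j => (width j * m j)%nat end.

Context (valid : nat -> nat -> Prop)
  (Hvalid : forall j n c, valid j n -> (c < m j)%nat -> valid (S j) (n + inc j c)%nat)
  (Hinj : forall j n n' c c', valid j n -> valid j n' -> (c < m j)%nat -> (c' < m j)%nat ->
    (n + inc j c = n' + inc j c')%nat -> n = n' /\ c = c').

Lemma desc_valid (f j n x : nat) : valid j n -> In x (desc f j n) -> valid (j + f)%nat x.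
Proof.
  revert j n. induction f as [|f IH]; intros j n Hn; simpl.
  - intros [<-|[]]. now rewrite Nat.add_0_r.
  - intros Hx. apply in_flat_map in Hx. destruct Hx as (c & Hc & Hx).
    apply in_seq in Hc. rewrite <- Nat.add_succ_comm. eapply IH; [|eassumption].
    apply Hvalid; [assumption|lia].
Qed.

(** By induction, children with a common descendant coincide, and [Hinj] then recovers the
    parent. *)
Lemma desc_disjoint (f j n n' x : nat) : valid j n -> valid j n' ->
  In x (desc f j n) -> In x (desc f j n') -> n = n'.
Proof.
  revert j n n'. induction f as [|f IH]; intros j n n' Hn Hn'; simpl.
  - intros [<-|[]] [<-|[]]. reflexivity.
  - intros Hx Hx'. apply in_flat_map in Hx, Hx'.
    destruct Hx as (c & Hc & Hx). destruct Hx' as (c' & Hc' & Hx').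
    apply in_seq in Hc, Hc'.
    assert (Hc1 : (c < m j)%nat) by lia. assert (Hc1' : (c' < m j)%nat) by lia.
    apply (Hinj j n n' c c'); auto. eapply IH; eauto.
Qed.

Lemma desc_NoDup (f j n : nat) : valid j n -> NoDup (desc f j n).
Proof.
  revert j n. induction f as [|f IH]; intros j n Hn; simpl.
  - repeat constructor. intros [].
  - apply NoDup_flat_map; [apply seq_NoDup| |].
    + intros c Hc. apply in_seq in Hc. apply IH, Hvalid; [assumption|lia].
    + intros c c' x Hc Hc' Hx Hx'. apply in_seq in Hc, Hc'.
      assert (Hc1 : (c < m j)%nat) by lia. assert (Hc1' : (c' < m j)%nat) by lia.
      apply (Hinj j n n c c'); auto.
      apply (desc_disjoint f (S j) _ _ x); auto.
Qed.

Definition hits (p : nat -> bool) (f j n : nat) : nat := length (filter p (desc f j n)).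

Lemma hits_S (p : nat -> bool) (f j n : nat) :
  INR (hits p (S f) j n)
  = rsum (fun c => INR (hits p f (S j) (n + inc j c)%nat)) (seq 0 (m j)).
Proof.
  unfold hits. simpl. induction (seq 0 (m j)) as [|c l IH]; simpl; [reflexivity|].
  rewrite filter_app, length_app, plus_INR, IH. reflexivity.
Qed.

(* The branch is chosen so that the marked proportion below the current node never
   grows. *)
Lemma avoiding_branch (p : nat -> nat -> bool) (J : nat -> nat) (root : nat) (M : R) :
  (forall j, 1 <= m j)%nat -> M < 1 ->
  (forall K, sum_f_R0 (fun i => INR (hits (p i) (J i) 0 root) / INR (width (J i))) K <= M) ->
  exists node digit : nat -> nat, node 0%nat = root /\
    (forall j, digit j < m j /\ node (S j) = node j + inc j (digit j))%nat /\
    (forall i, p i (node (J i)) = false).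
Proof.
  intros Hm HM Hroot.
  assert (Hw : forall j, 0 < INR (width j)).
  { intros j. apply lt_0_INR. induction j as [|j IH]; simpl; [lia|]. specialize (Hm j). nia. }
  (* The share of generation [J i] that is marked by [p i] and lies below [n]; set to 0 once level
     [J i] has been passed. *)
  set (mass := fun i j n => if le_dec j (J i)
     then INR (hits (p i) (J i - j) j n) / INR (width (J i)) else 0).
  assert (Hmass0 : forall i j n, 0 <= mass i j n).
  { intros i j n. unfold mass. destruct (le_dec j (J i)); [|lra].
    apply Rle_mult_inv_pos; [apply pos_INR|apply Hw]. }
  (* A node of level [j] carries the share [1 / width j] of later generations, so this says that the
     marked proportions below it add up to at most [M]. *)
  set (light := fun j n => forall K, sum_f_R0 (fun i => mass i j n) K <= M / INR (width j)).
  assert (Hmass : forall i j n,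
    rsum (fun c => mass i (S j) (n + inc j c)%nat) (seq 0 (m j)) <= mass i j n).
  { intros i j n. destruct (le_dec (S j) (J i)) as [H|H].
    - unfold mass. destruct (le_dec (S j) (J i)) as [_|]; [|contradiction].
      destruct (le_dec j (J i)) as [_|]; [|lia].
      replace (J i - j)%nat with (S (J i - S j)) by lia. rewrite hits_S.
      unfold rsum, Rdiv. apply Req_le.
      induction (seq 0 (m j)) as [|c l IH]; simpl; [ring|]. rewrite IH. ring.
    - apply Rle_trans with 0; [|apply Hmass0]. unfold mass.
      destruct (le_dec (S j) (J i)) as [|_]; [contradiction|].
      induction (seq 0 (m j)) as [|c l IH]; simpl; lra. }
  assert (Hstep : forall j n, exists c, light j n ->
             (c < m j)%nat /\ light (S j) (n + inc j c)%nat).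
  { intros j n. destruct (classic (light j n)) as [Hl|Hl]; [|exists 0%nat; tauto].
    destruct (monotone_pigeonhole
      (fun c K => sum_f_R0 (fun i => mass i (S j) (n + inc j c)%nat) K)
      (M / INR (width (S j))) (seq 0 (m j))) as (c & Hc & Hcl).
    - specialize (Hm j). destruct (m j); [lia|]. discriminate.
    - intros c K K' HK. apply sum_f_R0_mono; auto.
    - intros K. rewrite length_seq, rsum_sum_f_R0.
      apply Rle_trans with (sum_f_R0 (fun i => mass i j n) K).
      + apply sum_Rle. intros i _. apply Hmass.
      + apply Rle_trans with (1 := Hl K). apply Req_le. simpl. rewrite mult_INR.
        pose proof (Hw j). assert (0 < INR (m j)) by (apply lt_0_INR, Hm).
        field. lra.
    - exists c. intros _. apply in_seq in Hc. split; [lia|exact Hcl]. }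
  set (ch := fun j n => proj1_sig (constructive_indefinite_description _ (Hstep j n))).
  assert (Hch : forall j n, light j n ->
             (ch j n < m j)%nat /\ light (S j) (n + inc j (ch j n))%nat).
  { intros j n. exact (proj2_sig (constructive_indefinite_description _ (Hstep j n))). }
  set (node := fix node j := match j with O => root
     | S j => (node j + inc j (ch j (node j)))%nat end).
  assert (Hlight : forall j, light j (node j)).
  { induction j as [|j IH]; [|exact (proj2 (Hch _ _ IH))].
    intros K. simpl. unfold mass. rewrite Rdiv_1_r.
    refine (Rle_trans _ _ _ (Req_le _ _ _) (Hroot K)). apply sum_eq. intros i _.
    destruct (le_dec 0 (J i)); [|lia]. now rewrite Nat.sub_0_r. }
  exists node, (fun j => ch j (node j)). split; [reflexivity|]. split.
  - intros j. split; [exact (proj1 (Hch _ _ (Hlight j)))|reflexivity].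
  (* A marked node of level [J i] would have mass [1 / width], more than a light node may carry, as
     [M < 1]. *)
  - intros i. destruct (p i (node (J i))) eqn:Ep; [exfalso|reflexivity].
    pose proof (Hlight (J i) i) as H.
    assert (H1 : mass i (J i) (node (J i)) = 1 / INR (width (J i))).
    { unfold mass. destruct (le_dec (J i) (J i)); [|lia]. rewrite Nat.sub_diag.
      unfold hits. simpl. rewrite Ep. reflexivity. }
    assert (H2 : mass i (J i) (node (J i))
                 <= sum_f_R0 (fun i' => mass i' (J i) (node (J i))) i).
    { destruct i as [|i]; simpl; [lra|].
      assert (0 <= sum_f_R0 (fun i' => mass i' (J (S i)) (node (J (S i)))) i)
        by (apply cond_pos_sum; auto). lra. }
    specialize (Hw (J i)). unfold Rdiv in *.
    assert (0 < / INR (width (J i))) by now apply Rinv_0_lt_compat. nra.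
Qed.

End Tree.

(** * Continued fractions by the Euclidean algorithm *)

Section ContinuedFraction.

Context (theta : R) (Hth : 0 < theta < 1)
  (Hirr : forall p q : Z, q <> 0%Z -> theta <> IZR p / IZR q).

Fixpoint euclid (k : nat) : R * R :=
  match k with
  | O => (1, theta)
  | S k => let (x, y) := euclid k in (y, x - INR (Z.to_nat (Int_part (x / y))) * y)
  end.

(* Indices are shifted by one against the usual ones: [delta k] is
   ||q_(k-1) theta||, [quot k] is a_(k+1), [denom k] is q_(k-1). *)
Definition delta (k : nat) : R := fst (euclid k).
Definition quot (k : nat) : nat := Z.to_nat (Int_part (delta k / delta (S k))).

Fixpoint denom2 (k : nat) : nat * nat :=
  match k with
  | O => (0, 1)%nat
  | S k => let (x, y) := denom2 k in (y, quot k * y + x)%nat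
  end.
Definition denom (k : nat) : nat := fst (denom2 k).

Fixpoint numer2 (k : nat) : Z * Z :=
  match k with
  | O => (1, 0)%Z
  | S k => let (x, y) := numer2 k in (y, Z.of_nat (quot k) * y + x)%Z
  end.
Definition numer (k : nat) : Z := fst (numer2 k).

Lemma delta_rec (k : nat) : delta (S (S k)) = delta k - INR (quot k) * delta (S k).
Proof.
  unfold quot, delta; simpl. destruct (euclid k) as [x y]; reflexivity.
Qed.

Lemma denom_rec (k : nat) : denom (S (S k)) = (quot k * denom (S k) + denom k)%nat.
Proof. unfold denom; simpl. destruct (denom2 k); reflexivity. Qed.

Lemma numer_rec (k : nat) : numer (S (S k)) = (Z.of_nat (quot k) * numer (S k) + numer k)%Z.
Proof. unfold numer; simpl. destruct (numer2 k); reflexivity. Qed.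

Lemma denom_rec_INR (k : nat) :
  INR (denom (S (S k))) = INR (quot k) * INR (denom (S k)) + INR (denom k).
Proof. now rewrite denom_rec, plus_INR, mult_INR. Qed.

Lemma numer_rec_IZR (k : nat) :
  IZR (numer (S (S k))) = INR (quot k) * IZR (numer (S k)) + IZR (numer k).
Proof. now rewrite numer_rec, plus_IZR, mult_IZR, <- INR_IZR_INZ. Qed.

Lemma floor_pos_ge1 (x y : R) : 0 < y < x ->
  let a := Z.to_nat (Int_part (x / y)) in
  (1 <= a)%nat /\ 0 <= x - INR a * y < y.
Proof.
  intros Hxy a. destruct (base_Int_part (x / y)) as [H1 H2].
  assert (Hq : 1 < x / y).
  { apply Rmult_lt_reg_r with y; [lra|]. unfold Rdiv.
    rewrite Rmult_assoc, Rinv_l by lra. lra. }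
  assert (H3 : (0 < Int_part (x / y))%Z) by (apply lt_IZR; lra).
  assert (Ha : INR a = IZR (Int_part (x / y))).
  { unfold a. rewrite INR_IZR_INZ, Z2Nat.id by lia. reflexivity. }
  split; [unfold a; lia|]. rewrite Ha.
  assert (E : x = x / y * y) by (field; lra).
  set (t := x / y) in *. clearbody t. rewrite E. nra.
Qed.

Lemma cf_invariant (k : nat) :
  0 < delta (S k) < delta k /\ (1 <= denom (S k))%nat /\
  INR (denom (S k)) * theta - IZR (numer (S k)) = (-1) ^ k * delta (S k) /\
  INR (denom k) * theta - IZR (numer k) = - (-1) ^ k * delta k.
Proof.
  induction k as [|k (Hd & Hq & E1 & E0)].
  - unfold delta, denom, numer; simpl. repeat split; try lra; lia.
  - destruct (floor_pos_ge1 _ _ Hd) as [Ha Hr]. fold (quot k) in Ha, Hr.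
    assert (E2 : INR (denom (S (S k))) * theta - IZR (numer (S (S k)))
                 = (-1) ^ S k * delta (S (S k))).
    { rewrite denom_rec_INR, numer_rec_IZR, delta_rec. simpl.
      replace ((INR (quot k) * INR (denom (S k)) + INR (denom k)) * theta -
        (INR (quot k) * IZR (numer (S k)) + IZR (numer k))) with
       (INR (quot k) * (INR (denom (S k)) * theta - IZR (numer (S k)))
         + (INR (denom k) * theta - IZR (numer k))) by ring.
      rewrite E1, E0. ring. }
    assert (Hq2 : (1 <= denom (S (S k)))%nat) by (rewrite denom_rec; nia).
    rewrite delta_rec in *.
    (* A zero remainder would make [theta] rational. *)
    assert (Hnz : delta k - INR (quot k) * delta (S k) <> 0).
    { intros Hz. rewrite Hz, Rmult_0_r in E2.
      apply (Hirr (numer (S (S k))) (Z.of_nat (denom (S (S k))))); [lia|].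
      rewrite <- INR_IZR_INZ. apply le_INR in Hq2. simpl in Hq2.
      apply Rmult_eq_reg_r with (INR (denom (S (S k)))); [|lra].
      unfold Rdiv. rewrite Rmult_assoc, Rinv_l by lra. lra. }
    repeat split; try lra; try assumption.
    rewrite E1. simpl. ring.
Qed.

Lemma delta_pos (k : nat) : 0 < delta k.
Proof. destruct (cf_invariant k) as [H _]. lra. Qed.

Lemma delta_decr (k : nat) : delta (S k) < delta k.
Proof. destruct (cf_invariant k) as [H _]. lra. Qed.

Lemma quot_ge1 (k : nat) : (1 <= quot k)%nat.
Proof.
  destruct (cf_invariant k) as [H _]. exact (proj1 (floor_pos_ge1 _ _ H)).
Qed.

Lemma denom_pos (k : nat) : (1 <= denom (S k))%nat.
Proof. apply cf_invariant. Qed.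

Lemma denom_theta (k : nat) :
  INR (denom (S k)) * theta = IZR (numer (S k)) + (-1) ^ k * delta (S k).
Proof. destruct (cf_invariant k) as (_ & _ & H & _). lra. Qed.

Lemma denom_theta_prev (k : nat) :
  INR (denom k) * theta = IZR (numer k) - (-1) ^ k * delta k.
Proof. destruct (cf_invariant k) as (_ & _ & _ & H). lra. Qed.

Lemma denom_le (k : nat) : (denom k <= denom (S k))%nat.
Proof.
  destruct k as [|k]; [unfold denom; simpl; lia|].
  rewrite denom_rec. pose proof (quot_ge1 k). nia.
Qed.

Lemma denom_lt (k : nat) : (1 <= k)%nat -> (denom (S k) < denom (S (S k)))%nat.
Proof.
  intros Hk. destruct k as [|k]; [lia|].
  rewrite (denom_rec (S k)). pose proof (quot_ge1 (S k)). pose proof (denom_pos k). nia.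
Qed.

(** The determinant identity of consecutive convergents in metric form, invariant under a Euclidean
    step. It is the tool that trades denominators for remainders below. *)
Lemma denom_delta (k : nat) :
  INR (denom (S k)) * delta k + INR (denom k) * delta (S k) = 1.
Proof.
  induction k as [|k IH].
  - unfold denom, delta; simpl. ring.
  - rewrite denom_rec_INR, delta_rec. rewrite <- IH. ring.
Qed.

Lemma denom_unbounded (k : nat) : (k <= denom (S k))%nat.
Proof.
  induction k as [|k IH]; [lia|].
  destruct k as [|k]; [apply denom_pos|].
  pose proof (denom_lt (S k) ltac:(lia)). lia.
Qed.

(* Write (n, p) in the unimodular basis formed by two consecutive convergents:
   the coefficients have opposite signs, so the two contributions add up. *)
Lemma best_approximation (k : nat) (n p : Z) :
  (0 < n < Z.of_nat (denom (S k)))%Z -> delta k <= Rabs (IZR n * theta - IZR p).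
Proof.
  intros Hn.
  set (q1 := Z.of_nat (denom (S k))) in *. set (q0 := Z.of_nat (denom k)).
  set (p1 := numer (S k)). set (p0 := numer k).
  pose proof (denom_theta k) as E1. pose proof (denom_theta_prev k) as E0.
  pose proof (denom_delta k) as Edet. rewrite INR_IZR_INZ in E1, E0.
  rewrite !INR_IZR_INZ in Edet. fold q1 p1 in E1. fold q0 p0 in E0. fold q0 q1 in Edet.
  pose proof (delta_pos k) as D0. pose proof (delta_pos (S k)) as D1.
  assert (Hs2 : (-1) ^ k * (-1) ^ k = 1) by (destruct (sign_cases k) as [->| ->]; ring).
  assert (Hq0 : (0 <= q0)%Z) by lia.
  (* coefficients up to the common sign (-1)^k *)
  set (al := (n * p1 - p * q1)%Z). set (be := (p * q0 - n * p0)%Z).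
  assert (Hdet : IZR (p0 * q1 - p1 * q0) = (-1) ^ k).
  { rewrite minus_IZR, !mult_IZR.
    replace (IZR p0) with (IZR q0 * theta + (-1) ^ k * delta k) by lra.
    replace (IZR p1) with (IZR q1 * theta - (-1) ^ k * delta (S k)) by lra.
    rewrite <- (Rmult_1_r ((-1) ^ k)) at 3. rewrite <- Edet. ring. }
  assert (En : IZR (al * q0 + be * q1) = - (-1) ^ k * IZR n).
  { rewrite <- Hdet. rewrite <- opp_IZR, <- mult_IZR. f_equal. unfold al, be. ring. }
  assert (Ep : IZR (al * p0 + be * p1) = - (-1) ^ k * IZR p).
  { rewrite <- Hdet. rewrite <- opp_IZR, <- mult_IZR. f_equal. unfold al, be. ring. }
  assert (EE : IZR n * theta - IZR p = IZR al * delta k - IZR be * delta (S k)).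
  { assert (F : (-1) ^ k * (IZR n * theta - IZR p)
                = (-1) ^ k * (IZR al * delta k - IZR be * delta (S k))).
    { transitivity (- (IZR (al * q0 + be * q1) * theta - IZR (al * p0 + be * p1))).
      - rewrite En, Ep. ring.
      - rewrite !plus_IZR, !mult_IZR.
        replace (IZR p0) with (IZR q0 * theta + (-1) ^ k * delta k) by lra.
        replace (IZR p1) with (IZR q1 * theta - (-1) ^ k * delta (S k)) by lra.
        ring. }
    destruct (sign_cases k) as [Hs|Hs]; rewrite Hs in F; lra. }
  assert (Habs : (al * q0 + be * q1 = n \/ al * q0 + be * q1 = - n)%Z).
  { destruct (sign_cases k) as [Hs|Hs]; rewrite Hs in En.
    - right. apply eq_IZR. rewrite En, opp_IZR. ring.
    - left. apply eq_IZR. rewrite En. ring. }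
  (* Coefficients of equal sign would give a value of size at least [q1 > n], and [al = 0] would
     make [n] a multiple of [q1]. *)
  assert (Hcase : (1 <= al /\ be <= 0)%Z \/ (al <= -1 /\ 0 <= be)%Z).
  { destruct (Z.lt_trichotomy al 0) as [Ha|[Ha|Ha]].
    - right. split; [lia|]. destruct (Z_lt_le_dec be 0); [|lia]. nia.
    - exfalso. rewrite Ha in Habs. destruct (Z.eq_dec be 0) as [->|Hb]; nia.
    - left. split; [lia|]. destruct (Z_lt_le_dec 0 be); [|lia]. nia. }
  rewrite EE. destruct Hcase as [[Ha Hb]|[Ha Hb]]; apply IZR_le in Ha, Hb.
  - rewrite Rabs_pos_eq; nra.
  - rewrite Rabs_left1; nra.
Qed.

(** * Uniform approximation along a digit expansion *)

(** By [best_approximation] the orbit points are [delta k]-separated modulo 1. Measured from one of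
    them, they fall into distinct cells of length [delta k] meeting a window of half-width [rad]. *)
Lemma orbit_packing (k : nat) (rad : R) (l : list nat) :
  0 <= rad -> NoDup l -> (forall n, In n l -> (n < denom (S k))%nat) ->
  (forall n m, In n l -> In m l -> distZ ((INR n - INR m) * theta) <= rad) ->
  INR (length l) <= 2 * rad / delta k + 3.
Proof.
  intros H0 Hnd Hlt Hrad. pose proof (delta_pos k) as Hd.
  destruct l as [|n0 l0] eqn:El.
  { assert (0 <= 2 * rad / delta k) by (apply Rle_mult_inv_pos; lra). simpl. lra. }
  rewrite <- El in *.
  assert (Hn0 : In n0 l) by (rewrite El; left; reflexivity). clear El l0.
  set (near := fun n => proj1_sig (constructive_indefinite_description _
                 (distZ_attained ((INR n - INR n0) * theta)))).
  set (v := fun n => (INR n - INR n0) * theta - IZR (near n)).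
  assert (Hv : forall n, In n l -> - rad <= v n <= rad).
  { intros n Hn. specialize (Hrad n n0 Hn Hn0).
    assert (E : distZ ((INR n - INR n0) * theta) = Rabs (v n)).
    { exact (proj2_sig (constructive_indefinite_description _
                 (distZ_attained ((INR n - INR n0) * theta)))). }
    rewrite E in Hrad. revert Hrad. unfold Rabs. destruct (Rcase_abs (v n)); lra. }
  set (z := fun n => Int_part (v n / delta k)).
  assert (Hz : forall n, IZR (z n) * delta k <= v n < (IZR (z n) + 1) * delta k).
  { intros n. unfold z. destruct (base_Int_part (v n / delta k)) as [A B].
    assert (E : v n = v n / delta k * delta k) by (field; lra).
    set (t := v n / delta k) in *. clearbody t. rewrite E. nra. }
  assert (Hsep : forall n m, In n l -> In m l -> (n < m)%nat -> z n <> z m).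
  { intros n m Hn Hm Hnm E.
    pose proof (best_approximation k (Z.of_nat m - Z.of_nat n)
                 (near m - near n)) as HB.
    pose proof (Hlt m Hm). specialize (HB ltac:(lia)).
    rewrite !minus_IZR, <- !INR_IZR_INZ in HB.
    replace ((INR m - INR n) * theta - (IZR (near m) - IZR (near n))) with (v m - v n) in HB
      by (unfold v; ring).
    pose proof (Hz n) as Zn. pose proof (Hz m) as Zm. rewrite E in Zn.
    revert HB. unfold Rabs. destruct (Rcase_abs (v m - v n)); lra. }
  assert (Hinj : NoDup (map z l)).
  { apply Injective_map_NoDup_in; [|assumption].
    intros n m Hn Hm E. destruct (lt_eq_lt_dec n m) as [[H|H]|H]; [|assumption|].
    - exfalso. now apply (Hsep n m).
    - exfalso. apply (Hsep m n); auto. }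
  set (K := Z.to_nat (up (rad / delta k))).
  destruct (archimed (rad / delta k)) as [U1 U2].
  assert (Hq0 : 0 <= rad / delta k) by (apply Rle_mult_inv_pos; lra).
  assert (HK : INR K = IZR (up (rad / delta k))).
  { unfold K. rewrite INR_IZR_INZ, Z2Nat.id; [reflexivity|]. apply le_IZR; lra. }
  assert (Er : rad = rad / delta k * delta k) by (field; lra).
  assert (Hincl : incl (map z l)
            (map (fun i => (Z.of_nat i - Z.of_nat K)%Z) (seq 0 (2 * K + 1)))).
  { intros w Hw. apply in_map_iff in Hw. destruct Hw as (n & <- & Hn).
    pose proof (Hz n) as Zn. specialize (Hv n Hn).
    rewrite <- HK in U1, U2. set (t := rad / delta k) in *. clearbody t.
    assert (A : IZR (z n) < INR K) by nra.
    assert (B : - INR K < IZR (z n) + 1) by nra.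
    rewrite INR_IZR_INZ in A, B.
    apply lt_IZR in A. rewrite <- opp_IZR, <- plus_IZR in B. apply lt_IZR in B.
    apply in_map_iff. exists (Z.to_nat (z n + Z.of_nat K)). split; [lia|].
    apply in_seq. lia. }
  pose proof (NoDup_incl_length Hinj Hincl) as HL.
  rewrite !length_map, length_seq in HL. apply le_INR in HL.
  rewrite plus_INR, mult_INR in HL. simpl in HL.
  replace (2 * rad / delta k) with (2 * (rad / delta k)) by (field; lra). lra.
Qed.

Definition covered (y Q : R) : Prop :=
  exists n : nat, (1 <= n)%nat /\ INR n <= Q /\ distZ (INR n * theta - y) < / Q.

Lemma covered_by (y Q : R) (n : nat) (p : Z) : 0 < Q -> (1 <= n)%nat -> INR n <= Q ->
  Q * Rabs (INR n * theta - IZR p - y) < 1 -> covered y Q.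
Proof.
  intros HQ Hn HnQ H. exists n. repeat split; try assumption.
  apply Rle_lt_trans with (1 := distZ_le _ p).
  apply Rmult_lt_reg_l with Q; [assumption|]. rewrite Rinv_r by lra.
  replace (INR n * theta - y - IZR p) with (INR n * theta - IZR p - y) by ring.
  assumption.
Qed.

(** Signed position of [y] seen from an orbit point, oriented so that adding [denom (S k)] to [n]
    moves the point in the positive direction. *)
Definition coord (k n : nat) (p : Z) (y : R) : R :=
  (-1) ^ k * (y - (INR n * theta - IZR p)).

Lemma Rabs_coord (k n : nat) (p : Z) (y : R) :
  Rabs (INR n * theta - IZR p - y) = Rabs (coord k n p y).
Proof.
  unfold coord. rewrite Rabs_mult, pow_1_abs, Rmult_1_l, Rabs_minus_sym. reflexivity.
Qed.

Lemma coord_add_denom (k n j : nat) (p : Z) (y : R) :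
  coord k (n + j * denom (S k)) (p + Z.of_nat j * numer (S k)) y
  = coord k n p y - INR j * delta (S k).
Proof.
  unfold coord. rewrite plus_INR, mult_INR, plus_IZR, mult_IZR, <- INR_IZR_INZ.
  pose proof (denom_theta k) as E.
  replace ((INR n + INR j * INR (denom (S k))) * theta) with
    (INR n * theta + INR j * (INR (denom (S k)) * theta)) by ring.
  rewrite E. destruct (sign_cases k) as [->| ->]; ring.
Qed.

Lemma coord_sub_denom (k n : nat) (p : Z) (y : R) : (denom (S k) <= n)%nat ->
  coord k (n - denom (S k)) (p - numer (S k)) y = coord k n p y + delta (S k).
Proof.
  intros H. unfold coord. rewrite minus_INR, minus_IZR by assumption.
  pose proof (denom_theta k) as E.
  rewrite Rmult_minus_distr_r, E. destruct (sign_cases k) as [->| ->]; ring.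
Qed.

Lemma coord_add_next (k n : nat) (p : Z) (y : R) :
  coord k (n + denom (S (S k))) (p + numer (S (S k))) y = coord k n p y + delta (S (S k)).
Proof.
  unfold coord. rewrite plus_INR, plus_IZR.
  pose proof (denom_theta (S k)) as E. simpl in E.
  rewrite Rmult_plus_distr_r, E. destruct (sign_cases k) as [->| ->]; ring.
Qed.

Lemma coord_sub_prev (k n : nat) (p : Z) (y : R) : (denom k <= n)%nat ->
  coord k (n - denom k) (p - numer k) y = coord k n p y - delta k.
Proof.
  intros H. unfold coord. rewrite minus_INR, minus_IZR by assumption.
  pose proof (denom_theta_prev k) as E.
  rewrite Rmult_minus_distr_r, E. destruct (sign_cases k) as [->| ->]; ring.
Qed.

Lemma coord_SS (k n : nat) (p : Z) (y : R) : coord (S (S k)) n p y = coord k n p y.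
Proof. unfold coord. simpl. ring. Qed.

Lemma coord_S (k n : nat) (p : Z) (y : R) : coord (S k) n p y = - coord k n p y.
Proof. unfold coord. simpl. ring. Qed.

(* For [1 <= j < b], [(j + 2) ((b - j) delta_(k+1) + delta_(k+2))] must stay below
   [delta_k = a delta_(k+1) + delta_(k+2)]: this is what limits the digit to [b <= sqrt a]. *)
Definition admissible (k b : nat) : Prop :=
  (b = 0 \/ 2 * b <= quot k /\
   (b * b + 1 <= quot k \/ b * b <= quot k /\ 2 <= quot (S k)))%nat.

Lemma delta_rec_le (k : nat) : INR (quot k) * delta (S k) + delta (S (S k)) = delta k.
Proof. rewrite (delta_rec k). ring. Qed.

(** With [c = b - j], what is needed is that [(j + 2) c] remainders [delta (S k)] and [j + 1]
    remainders [delta (S (S k))] fit into [quot k] remainders [delta (S k)]. The first form of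
    [admissible] uses only that remainders decrease; the second uses that they halve when
    [quot (S k) >= 2]. *)
Lemma admissible_step (k b j : nat) : admissible k b -> (1 <= j < b)%nat ->
  INR (j + 2) * (INR (b - j) * delta (S k) + delta (S (S k))) <= delta k.
Proof.
  intros [->|[H2 H]] Hj; [lia|].
  assert (E : b = (j + (b - j))%nat) by lia.
  set (c := (b - j)%nat) in *. assert (Hc : (1 <= c)%nat) by lia. clearbody c. subst b.
  assert (Hj1 : (1 <= j)%nat) by lia. clear Hj.
  rewrite <- (delta_rec_le k).
  pose proof (delta_pos (S k)) as D1.
  pose proof (delta_pos (S (S k))) as D2.
  pose proof (delta_decr (S k)) as D12.
  rewrite plus_INR. change (INR 2) with 2.
  apply le_INR in Hc, Hj1. simpl in Hc, Hj1.
  destruct H as [H|[H H3]].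
  - apply le_INR in H. rewrite plus_INR, mult_INR, plus_INR in H. simpl in H.
    set (x := INR j) in *. set (u := INR c) in *. set (a := INR (quot k)) in *.
    assert (G : (x + 2) * u + (x + 1) <= a) by nra.
    set (d1 := delta (S k)) in *. set (d2 := delta (S (S k))) in *.
    assert ((x + 1) * d2 <= (x + 1) * d1) by nra.
    assert (((x + 2) * u + (x + 1)) * d1 <= a * d1) by nra. lra.
  - apply le_INR in H. rewrite !mult_INR, plus_INR in H.
    apply le_INR in H3. simpl in H3.
    pose proof (delta_rec_le (S k)) as E.
    pose proof (delta_pos (S (S (S k)))) as D3.
    set (x := INR j) in *. set (u := INR c) in *. set (a := INR (quot k)) in *.
    set (d1 := delta (S k)) in *. set (d2 := delta (S (S k))) in *.
    assert (Hd : 2 * d2 <= d1) by nra.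
    assert (G : (x + 2) * u + (x + 1) / 2 <= a) by nra.
    assert ((x + 1) * (2 * d2) <= (x + 1) * d1) by nra.
    assert (((x + 2) * u + (x + 1) / 2) * d1 <= a * d1) by nra. lra.
Qed.

(** The last of [n], [n + L], ..., [n + b L] not exceeding [Q] serves. If that is [n] itself and
    [n > denom k], then [y] lies between it and the point of [n - denom k], at distance [delta k];
    as [Q < 2 L], the nearer of the two works. *)
Lemma covered_first_scale (k n b : nat) (p : Z) (y Q : R) :
  (1 <= n < denom (S k))%nat -> admissible k b ->
  (INR b - 1) * delta (S k) <= coord k n p y <= INR b * delta (S k) + delta (S (S k)) ->
  INR (denom (S k)) <= Q < INR (denom (S (S k))) -> covered y Q.
Proof.
  intros Hn Hb Ht HQ. set (t := coord k n p y) in *.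
  set (L := denom (S k)) in *.
  pose proof (delta_pos (S k)) as D1.
  pose proof (delta_pos (S (S k))) as D2.
  pose proof (delta_decr (S k)) as D12.
  assert (HL1 : 1 <= INR L) by (apply (le_INR 1); unfold L; apply denom_pos).
  pose proof (denom_delta (S k)) as Edet'. fold L in Edet'.
  pose proof (denom_delta k) as Edet. fold L in Edet.
  pose proof (delta_pos k) as D0.
  pose proof (pos_INR (denom k)) as HP0.
  (* The full digit fits below [Q]: the distance is at most [delta (S k)], and [Q * delta (S k) < 1]
     by the determinant identity. *)
  destruct (Rle_dec (INR (n + b * L)) Q) as [Hbig|Hbig].
  { apply (covered_by y Q (n + b * L) (p + Z.of_nat b * numer (S k))); [lra|lia|assumption|].
    rewrite (Rabs_coord k). unfold L. rewrite coord_add_denom. fold t.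
    assert (Rabs (t - INR b * delta (S k)) <= delta (S k)).
    { unfold Rabs. destruct (Rcase_abs _); lra. }
    nra. }
  assert (Hj : exists j, (j < b)%nat /\ INR (n + j * L) <= Q < INR (n + S j * L)).
  { clear - Hbig HQ Hn. induction b as [|b IH].
    - exfalso. apply Hbig. apply Rle_trans with (2 := proj1 HQ). apply le_INR. lia.
    - destruct (Rle_dec (INR (n + b * L)) Q) as [H|H].
      + exists b. split; [lia|]. split; [assumption|]. lra.
      + destruct (IH H) as (j & Hj & H'). exists j. split; [lia|assumption]. }
  destruct Hj as (j & Hjb & HjQ).
  assert (HjbR : INR j + 1 <= INR b) by (rewrite <- S_INR; apply le_INR; lia).
  assert (Hnn : 0 <= t - INR j * delta (S k)) by nra.
  assert (HnL : INR n + 1 <= INR L) by (rewrite <- S_INR; apply le_INR; lia).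
  rewrite !plus_INR, !mult_INR, S_INR in HjQ.
  destruct j as [|j].
  (* With [x = S j], [Q < n + (x + 1) L < (x + 2) L], while [admissible_step] bounds the distance by
     [delta k / (x + 2)]. *)
  2:{ apply (covered_by y Q (n + S j * L) (p + Z.of_nat (S j) * numer (S k)));
        [lra|lia| rewrite plus_INR, mult_INR; lra|].
      rewrite (Rabs_coord k). unfold L. rewrite coord_add_denom. fold t.
      rewrite Rabs_pos_eq by assumption.
      pose proof (admissible_step k b (S j) Hb ltac:(lia)) as HA.
      rewrite plus_INR, minus_INR in HA by lia. change (INR 2) with 2 in HA.
      set (x := INR (S j)) in *.
      assert (HQ2 : Q < (x + 2) * INR L) by nra.
      assert (W : t - x * delta (S k) <= (INR b - x) * delta (S k) + delta (S (S k))) by lra.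
      assert (x <= INR b) by lra.
      apply Rle_lt_trans with (Q * ((INR b - x) * delta (S k) + delta (S (S k)))); [nra|].
      apply Rlt_le_trans with ((x + 2) * INR L * ((INR b - x) * delta (S k) + delta (S (S k)))).
      { apply Rmult_lt_compat_r; [nra|assumption]. }
      apply Rle_trans with (INR L * delta k); [|nra].
      rewrite (Rmult_comm (x + 2)), Rmult_assoc. apply Rmult_le_compat_l; lra. }
  simpl in Hnn, HjQ.
  destruct Hb as [Hb|[Hb _]]; [lia|].
  apply le_INR in Hb. rewrite mult_INR in Hb. change (INR 2) with 2 in Hb.
  pose proof (delta_rec_le k) as Er.
  assert (Ht0 : 0 <= t) by lra.
  destruct (le_lt_dec n (denom k)) as [HnP|HnP].
  (* Now [Q < L + P], and [2 b <= quot k] keeps the product with the distance below the determinant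
     identity. *)
  - apply (covered_by y Q n p); [lra|lia| lra|].
    rewrite (Rabs_coord k). fold t. rewrite Rabs_pos_eq by assumption.
    apply le_INR in HnP.
    assert (HPL : INR (denom k) <= INR L) by (apply le_INR; apply denom_le).
    set (P := INR (denom k)) in *. set (d1 := delta (S k)) in *. set (d2 := delta (S (S k))) in *.
    set (B := INR b) in *. set (a := INR (quot k)) in *.
    assert (HB1 : 1 <= B) by (simpl in HjbR; lra).
    apply Rle_lt_trans with (Q * (B * d1 + d2)); [nra|].
    apply Rlt_le_trans with ((INR L + P) * (B * d1 + d2)).
    { apply Rmult_lt_compat_r; nra. }
    rewrite <- Edet, <- Er.
    assert (2 * B * (INR L * d1) <= a * (INR L * d1)) by (apply Rmult_le_compat_r; nra).
    assert ((B - 1) * d1 * P <= (B - 1) * d1 * INR L) by (apply Rmult_le_compat_l; nra).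
    assert (P * d2 <= INR L * d1) by nra.
    nra.
  - (* between [n] and its right neighbour [n - denom k] *)
    assert (HBa : INR b * delta (S k) <= INR (quot k) * delta (S k)).
    { apply Rmult_le_compat_r; [lra|]. pose proof (pos_INR b). lra. }
    assert (Htd : t <= delta k) by lra.
    destruct (Rle_dec t (delta k / 2)) as [H|H].
    + apply (covered_by y Q n p); [lra|lia| lra|].
      rewrite (Rabs_coord k). fold t. rewrite Rabs_pos_eq by assumption. nra.
    + apply (covered_by y Q (n - denom k) (p - numer k)); [lra|lia| |].
      { apply Rle_trans with (INR n); [apply le_INR; lia|lra]. }
      rewrite (Rabs_coord k), coord_sub_prev by lia. fold t.
      rewrite Rabs_left1 by lra. nra.
Qed.

(** If [n] exceeds [Q], it is [m + denom (S (S k))] and cannot be used. Then [y] lies between the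
    points of [m] and [m + denom (S (S k)) - denom (S k)], one on each side, and the nearer one
    serves. *)
Lemma covered_second_scale (k n : nat) (p : Z) (y Q : R) :
  quot (S k) = 1%nat -> (1 <= n)%nat ->
  (n < denom (S (S k)) \/
    exists m, 1 <= m < denom (S k) /\ n = m + denom (S (S k)))%nat ->
  - delta (S (S (S k))) <= coord k n p y <= delta (S (S k)) ->
  INR (denom (S (S k))) <= Q < INR (denom (S (S (S k)))) -> covered y Q.
Proof.
  intros Hq Hn1 Hn Ht HQ.
  pose proof (delta_pos (S (S k))) as D2.
  pose proof (delta_pos (S (S (S k)))) as D3.
  pose proof (delta_decr (S (S k))) as D23.
  pose proof (denom_delta (S (S k))) as Edet.
  assert (HL2 : 1 <= INR (denom (S (S k)))) by (apply (le_INR 1), denom_pos).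
  destruct (Rle_dec (INR n) Q) as [HnQ|HnQ].
  { apply (covered_by y Q n p); [lra|lia|assumption|].
    rewrite (Rabs_coord k). set (t := coord k n p y) in *.
    assert (Rabs t <= delta (S (S k))) by (unfold Rabs; destruct (Rcase_abs _); lra).
    nra. }
  destruct Hn as [Hn|(m & Hm & ->)].
  { exfalso. apply HnQ. apply Rle_trans with (2 := proj1 HQ). apply le_INR. lia. }
  set (p' := (p - numer (S (S k)))%Z).
  replace p with (p' + numer (S (S k)))%Z in Ht by (unfold p'; ring).
  rewrite coord_add_next in Ht.
  pose proof (delta_rec_le (S k)) as Er. rewrite Hq in Er. simpl INR in Er.
  pose proof (denom_rec_INR (S k)) as Eq. rewrite Hq in Eq. simpl INR in Eq.
  assert (HL : INR (denom (S k)) <= INR (denom (S (S k)))) by (apply le_INR, denom_le).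
  assert (HmL : INR m + 1 <= INR (denom (S k))) by (rewrite <- S_INR; apply le_INR; lia).
  set (v := coord k m p' y) in *.
  (* Here [Q < L1 + L2], with [L1 d2 + L2 d1 = 1] for the two denominators and their remainders.
     Since [L1 <= L2] and [d2 < d1], rearrangement gives [(L1 + L2) (d1 + d2) <= 2]. *)
  assert (Hhalf : Q * ((delta (S k) + delta (S (S k))) / 2) < 1) by nra.
  destruct (Rle_dec (- v) ((delta (S k) + delta (S (S k))) / 2)) as [H|H].
  - apply (covered_by y Q m p'); [lra|lia|lra|].
    rewrite (Rabs_coord k). fold v. rewrite Rabs_left1 by lra. nra.
  - assert (HLn : (denom (S k) <= denom (S (S k)))%nat) by (apply denom_le).
    apply (covered_by y Q (m + denom (S (S k)) - denom (S k)) (p' + numer (S (S k)) - numer (S k)));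
      [lra|lia| |].
    { apply Rle_trans with (INR (denom (S (S k)))); [apply le_INR; lia|lra]. }
    rewrite (Rabs_coord k), coord_sub_denom, coord_add_next by lia. fold v.
    rewrite Rabs_pos_eq by lra. nra.
Qed.

(** * One step of the Cantor construction *)

(** The maximal block of partial quotients 1 starting at [k] has odd length. Being inductive, the
    predicate excludes an infinite block. *)
Inductive odd_run : nat -> Prop :=
| odd_run_one k : quot k = 1%nat -> quot (S k) <> 1%nat -> odd_run k
| odd_run_more k : quot k = 1%nat -> quot (S k) = 1%nat ->
    odd_run (S (S k)) -> odd_run k.

Lemma odd_run_quot (k : nat) : odd_run k -> quot k = 1%nat.
Proof. now intros []. Qed.

Lemma odd_run_S (k : nat) : odd_run k -> ~ odd_run (S k).
Proof.
  induction 1 as [k H1 H2|k H1 H2 H3 IH]; intros H.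
  - apply H2. now apply odd_run_quot.
  - inversion H as [k' E1 E2|k' E1 E2 E3]; subst.
    + apply E2. now apply odd_run_quot.
    + now apply IH.
Qed.

(* A step from position [k] advances by one partial quotient, or by two when
   the second one is 1; the parities of the runs of ones are watched so that
   no step ever consists of a single partial quotient 1. *)
Definition single (k : nat) : bool :=
  if excluded_middle_informative ((2 <= quot k)%nat /\ ~ odd_run (S k))
  then true else false.

Definition next (k : nat) : nat := if single k then S k else S (S k).

(** The two square roots match the two alternatives in [admissible]. *)
Definition top_digit (k : nat) : nat :=
  if (single k && (2 <=? quot (S k))%nat)%bool
  then Nat.sqrt (quot k) else Nat.sqrt (quot k - 1).

Definition nchild (k : nat) : nat :=
  if single k then S (top_digit k) else S (S (top_digit k)).

(** The extra child of a double step has offset [denom (S (S k))]: digit 0 followed by digit 1. *)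
Definition incr (k c : nat) : nat :=
  if (c <=? top_digit k)%nat then (c * denom (S k))%nat else denom (S (S k)).

Definition incr_num (k c : nat) : Z :=
  if (c <=? top_digit k)%nat then (Z.of_nat c * numer (S k))%Z else numer (S (S k)).

(** A quotient 1 at a position that starts no odd block is followed by another 1, and the two are
    consumed together. A larger quotient before an odd block takes along the first 1, leaving an
    even block. *)
Lemma step_cases (k : nat) : ~ odd_run k ->
  (single k = true /\ (2 <= quot k)%nat /\ ~ odd_run (S k)) \/
  (single k = false /\ quot (S k) = 1%nat /\ ~ odd_run (S (S k))).
Proof.
  intros Hk. unfold single.
  destruct (excluded_middle_informative _) as [[H1 H2]|H]; [left; auto|right].
  split; [reflexivity|]. pose proof (quot_ge1 k) as Hq.
  destruct (le_lt_dec 2 (quot k)) as [H2|H2].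
  - assert (H3 : odd_run (S k)) by (apply NNPP; tauto).
    split; [now apply odd_run_quot|now apply odd_run_S].
  - assert (E : quot k = 1%nat) by lia.
    assert (E' : quot (S k) = 1%nat).
    { apply NNPP. intros E'. apply Hk. now constructor. }
    split; [assumption|]. intros Ho. apply Hk. now constructor 2.
Qed.

Lemma next_not_odd_run (k : nat) : ~ odd_run k -> ~ odd_run (next k).
Proof.
  intros H. unfold next. destruct (step_cases k H) as [(-> & _ & ?)|(-> & _ & ?)]; assumption.
Qed.

Lemma top_digit_admissible (k c : nat) : ~ odd_run k -> (c <= top_digit k)%nat ->
  admissible k c /\ (c < quot k)%nat.
Proof.
  intros Hk. unfold top_digit, admissible.
  pose proof (quot_ge1 k) as Hq.
  pose proof (Nat.sqrt_spec (quot k) (Nat.le_0_l _)) as S1.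
  pose proof (Nat.sqrt_spec (quot k - 1) (Nat.le_0_l _)) as S2.
  set (s1 := Nat.sqrt (quot k)) in *. set (s2 := Nat.sqrt (quot k - 1)) in *.
  destruct (step_cases k Hk) as [(-> & H & _)|(-> & H & _)]; cbn [andb].
  - destruct (Nat.leb_spec 2 (quot (S k))) as [H2|H2]; cbn [andb]; cbv iota; intros Hc.
    + assert (c = 0 \/ c = 1 \/ 2 <= c)%nat as [->|[->|Hc2]] by lia; [split; [auto|lia]| |].
      * split; [right; split; lia|lia].
      * assert (c * c <= quot k)%nat by (pose proof (Nat.mul_le_mono _ _ _ _ Hc Hc); lia).
        split; [right; split; [nia|right; lia]|nia].
    + assert (c * c <= quot k - 1)%nat by (pose proof (Nat.mul_le_mono _ _ _ _ Hc Hc); lia).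
      split; [right; split; [nia|left; nia]|nia].
  - cbv iota. intros Hc.
    assert (c * c <= quot k - 1)%nat by (pose proof (Nat.mul_le_mono _ _ _ _ Hc Hc); lia).
    destruct c as [|c]; [split; [auto|lia]|].
    split; [right; split; [|left; lia]|nia].
    destruct c as [|c]; [nia|nia].
Qed.

Lemma child_cases (k c : nat) : ~ odd_run k -> (c < nchild k)%nat ->
  ((c <= top_digit k)%nat /\ incr k c = (c * denom (S k))%nat /\
     incr_num k c = (Z.of_nat c * numer (S k))%Z) \/
  (c = S (top_digit k) /\ single k = false /\ quot (S k) = 1%nat /\
     incr k c = denom (S (S k)) /\ incr_num k c = numer (S (S k))).
Proof.
  intros Hk Hc. unfold incr, incr_num.
  destruct (Nat.leb_spec c (top_digit k)) as [H|H]; [left; auto|right].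
  unfold nchild in Hc. destruct (step_cases k Hk) as [(E & _)|(E & E2 & _)]; rewrite E in *.
  - lia.
  - repeat split; auto. lia.
Qed.

Lemma child_small_lt (k n c : nat) : ~ odd_run k -> (n < denom (S k))%nat ->
  (c <= top_digit k)%nat -> (n + c * denom (S k) < denom (S (S k)))%nat.
Proof.
  intros Hk Hn Hc. destruct (top_digit_admissible k c Hk Hc) as [_ H].
  rewrite denom_rec. nia.
Qed.

Lemma denom_pair (k : nat) : quot (S k) = 1%nat ->
  denom (S (S (S k))) = (denom (S (S k)) + denom (S k))%nat.
Proof. intros H. rewrite (denom_rec (S k)), H. lia. Qed.

Lemma child_bound (k n c : nat) : ~ odd_run k -> (c < nchild k)%nat ->
  (1 <= n < denom (S k))%nat -> (1 <= n + incr k c < denom (S (next k)))%nat.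
Proof.
  intros Hk Hc Hn. split; [lia|].
  destruct (child_cases k c Hk Hc) as [(H & -> & _)|(H & E & Eq & -> & _)].
  - apply Nat.lt_le_trans with (1 := child_small_lt k n c Hk (proj2 Hn) H).
    unfold next. destruct (single k); [lia|]. apply denom_le.
  - unfold next. rewrite E, denom_pair by assumption. lia.
Qed.

Lemma child_inj (k n1 n2 c1 c2 : nat) : ~ odd_run k ->
  (c1 < nchild k)%nat -> (c2 < nchild k)%nat ->
  (n1 < denom (S k))%nat -> (n2 < denom (S k))%nat ->
  (n1 + incr k c1 = n2 + incr k c2)%nat -> n1 = n2 /\ c1 = c2.
Proof.
  intros Hk Hc1 Hc2 Hn1 Hn2 E.
  destruct (child_cases k c1 Hk Hc1) as [(H1 & E1 & _)|(H1 & _ & _ & E1 & _)];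
  destruct (child_cases k c2 Hk Hc2) as [(H2 & E2 & _)|(H2 & _ & _ & E2 & _)];
  rewrite E1, E2 in E.
  - assert (c1 = c2) by nia. subst c2. split; [lia|reflexivity].
  - pose proof (child_small_lt k n1 c1 Hk Hn1 H1). lia.
  - pose proof (child_small_lt k n2 c2 Hk Hn2 H2). lia.
  - split; [lia|congruence].
Qed.

(** The interval modulo integers that contains everything below node [n]; it reaches [delta k]
    forwards and [delta (S k)] backwards. *)
Definition in_cyl (k n : nat) (p : Z) (y : R) : Prop :=
  - delta (S k) <= coord k n p y <= delta k.

(** An ordinary child keeps its digit, [b = c]. The extra child moves backwards by [delta (S (S k))]
    and stays within the range of [b = 0]. *)
Lemma child_coord (k n c : nat) (p : Z) (y : R) :
  ~ odd_run k -> (c < nchild k)%nat ->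
  in_cyl (next k) (n + incr k c) (p + incr_num k c) y ->
  exists b, admissible k b /\ (b < quot k)%nat /\
    (INR b - 1) * delta (S k) <= coord k n p y <= INR b * delta (S k) + delta (S (S k)).
Proof.
  intros Hk Hc. unfold in_cyl, next.
  pose proof (delta_pos (S (S k))) as D2.
  pose proof (delta_decr (S k)) as D12.
  pose proof (delta_decr (S (S k))) as D23.
  pose proof (delta_rec_le (S k)) as Er.
  destruct (child_cases k c Hk Hc) as [(H & -> & ->)|(H & Es & Eq & -> & ->)].
  - destruct (top_digit_admissible k c Hk H) as [Ha Hlt]. intros Hy.
    exists c. split; [assumption|]. split; [assumption|].
    destruct (single k).
    + rewrite coord_S, coord_add_denom in Hy by assumption. lra.
    + rewrite coord_SS, coord_add_denom in Hy by assumption. lra.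
  - rewrite Es, coord_SS, coord_add_next by assumption. intros Hy.
    rewrite Eq in Er. simpl INR in Er.
    exists 0%nat. split; [left; reflexivity|].
    split; [apply quot_ge1|]. simpl INR. lra.
Qed.

Lemma child_in_cyl (k n c : nat) (p : Z) (y : R) :
  ~ odd_run k -> (c < nchild k)%nat ->
  in_cyl (next k) (n + incr k c) (p + incr_num k c) y -> in_cyl k n p y.
Proof.
  intros Hk Hc Hy. destruct (child_coord k n c p y Hk Hc Hy) as (b & _ & Hb & Ht).
  unfold in_cyl. pose proof (delta_pos (S k)) as D1.
  pose proof (delta_rec_le k) as Er. pose proof (pos_INR b).
  apply lt_INR in Hb.
  assert (0 <= INR b * delta (S k) <= INR (quot k) * delta (S k)) by nra. lra.
Qed.

Lemma child_covered (k n c : nat) (p : Z) (y Q : R) :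
  ~ odd_run k -> (c < nchild k)%nat -> (1 <= n < denom (S k))%nat ->
  in_cyl (next k) (n + incr k c) (p + incr_num k c) y ->
  INR (denom (S k)) <= Q < INR (denom (S (next k))) -> covered y Q.
Proof.
  intros Hk Hc Hn Hy HQ. destruct (child_coord k n c p y Hk Hc Hy) as (b & Ha & _ & Ht).
  destruct (Rlt_le_dec Q (INR (denom (S (S k))))) as [H|H].
  { apply (covered_first_scale k n b p); auto; lra. }
  pose proof (child_cases k c Hk Hc) as CC.
  unfold next in *. destruct (step_cases k Hk) as [(Es & _)|(Es & Eq & _)]; rewrite Es in *.
  { lra. }
  apply (covered_second_scale k (n + incr k c) (p + incr_num k c)); auto.
  - lia.
  - destruct CC as [(H' & -> & _)|(_ & _ & _ & -> & _)].
    + left. apply child_small_lt; [assumption|lia|assumption].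
    + right. exists n. lia.
  - unfold in_cyl in Hy. rewrite coord_SS in Hy. lra.
  - lra.
Qed.

(* With [N] children so far, the growth lemma keeps [4 N^2 >= weight k * denom (S k)]
   up to a constant; the weight 3 absorbs the loss of a step with [quot k = 4]
   before a run of ones. *)
Definition weight (k : nat) : nat := if (quot k =? 1)%nat then 3%nat else 4%nat.

(** With [a = quot k], the denominator grows by a factor at most [a + 1] in a single step and
    [a + 2] in a double one. Two ones are the tight case: two children and weight 3 give exactly
    [4 * 3 = 2 * 2 * 3]. *)
Lemma child_growth (k : nat) : ~ odd_run k ->
  (weight (next k) * denom (S (next k)) <= nchild k * nchild k * (weight k * denom (S k)))%nat.
Proof.
  intros Hk. pose proof (quot_ge1 k) as Hq.
  pose proof (denom_le k) as HP.
  unfold nchild, next, top_digit.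
  pose proof (Nat.sqrt_spec (quot k) (Nat.le_0_l _)) as S1.
  pose proof (Nat.sqrt_spec (quot k - 1) (Nat.le_0_l _)) as S2.
  set (s1 := Nat.sqrt (quot k)) in *. set (s2 := Nat.sqrt (quot k - 1)) in *.
  pose proof (denom_rec k) as Er.
  destruct (step_cases k Hk) as [(-> & H & _)|(-> & H & _)]; cbn [andb]; cbv iota.
  - unfold weight at 2. destruct (Nat.eqb_spec (quot k) 1) as [E|_]; [lia|].
    rewrite Er. destruct (Nat.leb_spec 2 (quot (S k))) as [H2|H2]; unfold weight.
    + destruct (Nat.eqb_spec (quot (S k)) 1) as [E|_]; [lia|].
      assert (quot k * denom (S k) + denom k <= (quot k + 1) * denom (S k))%nat by nia.
      assert ((quot k + 1) * denom (S k) <= S s1 * S s1 * denom (S k))%nat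
        by (apply Nat.mul_le_mono_r; lia).
      lia.
    + pose proof (quot_ge1 (S k)).
      destruct (Nat.eqb_spec (quot (S k)) 1) as [_|E]; [|lia].
      assert (quot k * denom (S k) + denom k <= (quot k + 1) * denom (S k))%nat by nia.
      assert (3 * (quot k + 1) * denom (S k) <= 4 * (S s2 * S s2) * denom (S k))%nat.
      { apply Nat.mul_le_mono_r.
        assert (quot k = 2 \/ 3 <= quot k)%nat as [E|E] by lia; [|nia].
        assert (1 <= s2)%nat by nia. nia. }
      lia.
  - rewrite denom_pair, Er by assumption.
    assert (quot k * denom (S k) + denom k + denom (S k) <= (quot k + 2) * denom (S k))%nat by nia.
    assert (weight (S (S k)) <= 4)%nat by (unfold weight; destruct (_ =? _)%nat; lia).
    apply Nat.le_trans with (4 * ((quot k + 2) * denom (S k)))%nat; [nia|].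
    rewrite !Nat.mul_assoc. apply Nat.mul_le_mono_r.
    unfold weight. destruct (Nat.eqb_spec (quot k) 1) as [E|E]; nia.
Qed.

(** Transfers a growth bound on consecutive denominators to whole steps: the second quotient of a
    double step is 1, which costs a factor 2. *)
Lemma next_denom_le (k : nat) : ~ odd_run k ->
  (denom (S (next k)) <= 2 * denom (S (S k)))%nat.
Proof.
  intros Hk. unfold next. pose proof (denom_le (S k)).
  destruct (step_cases k Hk) as [(-> & _)|(-> & H1 & _)]; [lia|].
  rewrite denom_pair by assumption. lia.
Qed.

Lemma next_denom_lt (k : nat) : (1 <= k)%nat -> (denom (S k) < denom (S (next k)))%nat.
Proof.
  intros Hk. unfold next. pose proof (denom_lt k Hk).
  destruct (single k); [lia|]. pose proof (denom_le (S (S k))). lia.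
Qed.

(** * The Cantor set *)

Section Cantor.

Context (k0 : nat) (Hk0 : (2 <= k0)%nat) (Hrun : ~ odd_run k0).

Fixpoint pos (j : nat) : nat :=
  match j with O => k0 | S j => next (pos j) end.
Definition scale (j : nat) : nat := denom (S (pos j)).
Definition arity (j : nat) : nat := nchild (pos j).
Definition offset (j c : nat) : nat := incr (pos j) c.

Lemma pos_not_odd_run (j : nat) : ~ odd_run (pos j).
Proof. induction j; simpl; [assumption|]. now apply next_not_odd_run. Qed.

Lemma pos_ge (j : nat) : (k0 <= pos j)%nat.
Proof.
  induction j as [|j IH]; simpl; [lia|]. unfold next. destruct (single _); lia.
Qed.

Lemma scale_lt (j : nat) : (scale j < scale (S j))%nat.
Proof.
  apply next_denom_lt; try assumption. pose proof (pos_ge j). lia.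
Qed.

Lemma scale_ge (j : nat) : (k0 + j <= scale j)%nat.
Proof.
  induction j as [|j IH].
  - unfold scale. simpl. pose proof (denom_unbounded k0). lia.
  - pose proof (scale_lt j). lia.
Qed.

Definition node_ok (j n : nat) : Prop := (1 <= n < scale j)%nat.

Lemma node_ok_child (j n c : nat) : node_ok j n -> (c < arity j)%nat ->
  node_ok (S j) (n + offset j c)%nat.
Proof.
  intros Hn Hc.
  exact (child_bound (pos j) n c (pos_not_odd_run j) Hc Hn).
Qed.

Lemma node_ok_inj (j n n' c c' : nat) : node_ok j n -> node_ok j n' ->
  (c < arity j)%nat -> (c' < arity j)%nat ->
  (n + offset j c = n' + offset j c')%nat -> n = n' /\ c = c'.
Proof.
  intros Hn Hn' Hc Hc'.
  apply (child_inj (pos j)); try assumption; try apply pos_not_odd_run.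
  - apply Hn.
  - apply Hn'.
Qed.

Lemma root_ok : node_ok 0 1.
Proof. pose proof (scale_ge 0). unfold node_ok. lia. Qed.

(** [child_growth] telescopes, and weights between 3 and 4 cost at most [4 / 3 <= 2]. *)
Lemma scale_le_width (j : nat) :
  (scale j <= 2 * scale 0 * (width arity j * width arity j))%nat.
Proof.
  assert (H : (weight (pos j) * scale j
    <= width arity j * width arity j * (weight k0 * scale 0))%nat).
  { induction j as [|j IH]; [simpl; lia|].
    pose proof (child_growth (pos j) (pos_not_odd_run j)) as G.
    apply Nat.le_trans with (1 := G). fold (scale j). simpl width.
    unfold arity at 2 4. simpl pos in IH. nia. }
  assert (3 <= weight (pos j))%nat by (unfold weight; destruct (_ =? _)%nat; lia).
  assert (weight k0 <= 4)%nat by (unfold weight; destruct (_ =? _)%nat; lia).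
  nia.
Qed.

Lemma limit_point (node digit : nat -> nat) :
  (forall j, digit j < arity j /\ node (S j) = node j + offset j (digit j))%nat ->
  exists (y : R) (p : nat -> Z), 0 <= y < 1 /\
    (forall j, p (S j) = (p j + incr_num (pos j) (digit j))%Z) /\
    forall j, in_cyl (pos j) (node j) (p j) y.
Proof.
  intros Hnode.
  set (p := fix p j := match j with O => 0%Z
     | S j => (p j + incr_num (pos j) (digit j))%Z end).
  set (x := fun j => INR (node j) * theta - IZR (p j)).
  (* [u] and [v] are the cylinder's endpoints; which one is on the left depends on the parity of
     [pos j]. *)
  set (u := fun j => x j - (-1) ^ pos j * delta (S (pos j))).
  set (v := fun j => x j + (-1) ^ pos j * delta (pos j)).
  assert (Huv : forall j y, in_cyl (pos j) (node j) (p j) y <->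
            Rmin (u j) (v j) <= y <= Rmax (u j) (v j)).
  { intros j y. unfold in_cyl, coord. fold (x j). unfold u, v.
    pose proof (delta_pos (pos j)) as D0.
    pose proof (delta_pos (S (pos j))) as D1.
    destruct (sign_cases (pos j)) as [-> | ->].
    - rewrite Rmin_left, Rmax_right by lra. lra.
    - rewrite Rmin_right, Rmax_left by lra. lra. }
  assert (Hsub : forall j y, in_cyl (pos (S j)) (node (S j)) (p (S j)) y ->
            in_cyl (pos j) (node j) (p j) y).
  { intros j y. destruct (Hnode j) as [Hd ->].
    apply child_in_cyl; try assumption. apply pos_not_odd_run. }
  assert (Hmm : forall a b, Rmin a b <= Rmax a b).
  { intros a b. apply Rle_trans with (1 := Rmin_l a b). apply Rmax_l. }
  destruct (nested_intervals (fun j => Rmin (u j) (v j)) (fun j => Rmax (u j) (v j)))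
    as [y Hy].
  - intros j. apply Hmm.
  - intros j. apply (Huv j), Hsub, Huv. split; [lra|apply Hmm].
  - intros j. apply (Huv j), Hsub, Huv. split; [apply Hmm|lra].
  (* Shifting every numerator by the integer part of [y] moves the limit point into [[0,1)]. *)
  - exists (y - IZR (Int_part y)), (fun j => (p j + Int_part y)%Z).
    destruct (base_Int_part y) as [I1 I2]. split; [lra|]. split.
    + intros j. simpl. ring.
    + intros j. destruct (Huv j y) as [_ H]. specialize (H (Hy j)).
      unfold in_cyl, coord in *. rewrite plus_IZR.
      replace (y - IZR (Int_part y) - (INR (node j) * theta - (IZR (p j) + IZR (Int_part y))))
        with (y - (INR (node j) * theta - IZR (p j))) by ring. exact H.
Qed.

Lemma node_ok_branch (node digit : nat -> nat) : node 0%nat = 1%nat ->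
  (forall j, digit j < arity j /\ node (S j) = node j + offset j (digit j))%nat ->
  forall j, node_ok j (node j).
Proof.
  intros H0 Hnode. induction j as [|j IH]; [rewrite H0; exact root_ok|].
  destruct (Hnode j) as [Hd ->]. now apply node_ok_child.
Qed.

Lemma scale_bracket (x : R) : INR (scale 0) <= x ->
  exists j, INR (scale j) <= x < INR (scale (S j)).
Proof.
  intros Hx. destruct (INR_unbounded x) as [J HJ].
  assert (HJ' : x < INR (scale J)).
  { apply Rlt_le_trans with (1 := HJ). apply le_INR. pose proof (scale_ge J). lia. }
  clear HJ. induction J as [|J IH]; [lra|].
  destruct (Rlt_le_dec x (INR (scale J))) as [H|H]; [auto|]. now exists J.
Qed.

Lemma branch_in_U1 (node digit : nat -> nat) (y : R) (p : nat -> Z) :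
  node 0%nat = 1%nat ->
  (forall j, digit j < arity j /\ node (S j) = node j + offset j (digit j))%nat ->
  0 <= y < 1 ->
  (forall j, p (S j) = (p j + incr_num (pos j) (digit j))%Z) ->
  (forall j, in_cyl (pos j) (node j) (p j) y) -> U1 theta y.
Proof.
  intros H0 Hnode Hy Hp Hcyl. split; [assumption|].
  exists (INR (scale 0)). intros Q HQ.
  destruct (scale_bracket Q ltac:(lra)) as [j Hj].
  pose proof (Hcyl (S j)) as HS. destruct (Hnode j) as [Hd E].
  rewrite E, Hp in HS.
  apply (child_covered (pos j) (node j) (digit j) (p j) y Q); try assumption.
  - apply pos_not_odd_run.
  - exact (node_ok_branch node digit H0 Hnode j).
Qed.

(** The numerator [p] is free, so the cylinder is taken modulo 1. *)
Definition meets (U : R -> Prop) (j n : nat) : bool :=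
  if excluded_middle_informative (exists x p, U x /\ in_cyl (pos j) n p x)
  then true else false.

(** Nodes whose cylinders meet [U] have orbit points within [r + 2 * delta (pos j)] of each other
    modulo 1, so [orbit_packing] counts them. *)
Lemma hits_le (U : R -> Prop) (r : R) (j : nat) : 0 < r ->
  (forall x y, U x -> U y -> distZ (x - y) <= r) ->
  INR (hits arity offset (meets U j) j 0 1) <= 4 * r * INR (scale j) + 7.
Proof.
  intros Hr HU. unfold hits. set (l := filter _ _).
  pose proof (delta_pos (pos j)) as D0.
  pose proof (delta_pos (S (pos j))) as D1.
  pose proof (delta_decr (pos j)) as D01.
  assert (Hl : forall n, In n l -> node_ok j n /\ exists x p, U x /\ in_cyl (pos j) n p x).
  { intros n Hn. apply filter_In in Hn. destruct Hn as [Hn Hm]. split.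
    - apply (desc_valid arity offset node_ok node_ok_child j 0 1 n root_ok Hn).
    - unfold meets in Hm. destruct (excluded_middle_informative _); [assumption|discriminate]. }
  assert (HL : INR (length l) <= 2 * (r + 2 * delta (pos j)) / delta (pos j) + 3).
  { apply (orbit_packing); [lra| | |].
    - apply NoDup_filter. apply (desc_NoDup _ _ node_ok node_ok_child node_ok_inj), root_ok.
    - intros n Hn. apply Hl, Hn.
    - intros n n' Hn Hn'.
      destruct (Hl n Hn) as (_ & x & p & Ux & Hx).
      destruct (Hl n' Hn') as (_ & x' & p' & Ux' & Hx').
      destruct (distZ_attained (x - x')) as [z Hz].
      specialize (HU x x' Ux Ux'). rewrite Hz in HU.
      apply Rle_trans with (1 := distZ_le _ (p - p' + z)).
      rewrite plus_IZR, minus_IZR. unfold in_cyl, coord in Hx, Hx'.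
      revert HU. unfold Rabs.
      destruct (sign_cases (pos j)) as [E|E]; rewrite E in Hx, Hx';
      destruct (Rcase_abs (x - x' - IZR z)); destruct (Rcase_abs _); lra. }
  apply Rle_trans with (1 := HL).
  pose proof (denom_delta (pos j)) as Ed. fold (scale j) in Ed.
  pose proof (denom_le (pos j)) as HP. fold (scale j) in HP.
  apply le_INR in HP. pose proof (pos_INR (denom (pos j))).
  assert (Hd : 1 <= 2 * INR (scale j) * delta (pos j)) by nra.
  replace (2 * (r + 2 * delta (pos j)) / delta (pos j) + 3)
    with (2 * r * / delta (pos j) + 7) by (field; lra).
  assert (/ delta (pos j) <= 2 * INR (scale j)).
  { apply Rmult_le_reg_r with (delta (pos j)); [assumption|]. rewrite Rinv_l; lra. }
  nra.
Qed.

Lemma scale_gt0 (j : nat) : 1 <= INR (scale j).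
Proof. apply (le_INR 1). pose proof (scale_ge j). lia. Qed.

Lemma width_gt0 (j : nat) : 0 < INR (width arity j).
Proof.
  apply lt_0_INR. pose proof (scale_le_width j). pose proof (scale_ge j).
  destruct (width arity j); lia.
Qed.

Lemma inv_width_le (j : nat) :
  / INR (width arity j) <= exp ((ln (2 * INR (scale 0)) - ln (INR (scale j))) / 2).
Proof.
  pose proof (scale_le_width j) as H. apply le_INR in H.
  rewrite !mult_INR in H. change (INR 2) with 2 in H.
  pose proof (width_gt0 j) as HW. pose proof (scale_gt0 j) as H1. pose proof (scale_gt0 0) as H2.
  assert (HL : ln (INR (scale j)) <= ln (2 * INR (scale 0)) + 2 * ln (INR (width arity j))).
  { apply Rle_trans with
      (ln (2 * INR (scale 0) * (INR (width arity j) * INR (width arity j)))).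
    - apply ln_monotone; lra.
    - rewrite ln_mult; [|lra|now apply Rmult_lt_0_compat].
      rewrite (ln_mult _ (INR (width arity j))) by assumption. lra. }
  rewrite <- (exp_ln (INR (width arity j))) at 1 by assumption.
  rewrite <- exp_Ropp. apply exp_monotone. lra.
Qed.

(* The smaller of two estimates, taken at the scales just above and just below [r], is at
   most their weighted geometric mean. *)
Lemma mass_bound (w C : R) : 0 < w -> 0 < C ->
  (forall j, INR (scale (S j)) <= C * Rpower (INR (scale j)) w) ->
  exists K, 0 < K /\ forall (U : R -> Prop) (r : R), 0 < r <= / INR (scale 0) ->
    (forall x y, U x -> U y -> distZ (x - y) <= r) ->
    exists j, INR (hits arity offset (meets U j) j 0 1) / INR (width arity j)
              <= K * Rpower r (/ (w + 1)).
Proof.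
  intros Hw HC Hgrow. set (s := / (w + 1)).
  assert (Hs : 0 < s) by (apply Rinv_0_lt_compat; lra).
  assert (Hsw : s * w = 1 - s) by (unfold s; field; lra).
  assert (Hs1 : 0 < 1 - s) by (rewrite <- Hsw; nra).
  set (S0 := ln (2 * INR (scale 0))).
  (* The 11 is [4 + 7] from [hits_le]: the count is at most 11 when [r * scale <= 1], and at most
     [11 * r * scale] when [r * scale >= 1]. *)
  exists (11 * exp (S0 / 2 + s * ln C / 2)).
  split; [pose proof (exp_pos (S0 / 2 + s * ln C / 2)); lra|].
  intros U r Hr HU.
  assert (Hx : INR (scale 0) <= / r).
  { rewrite <- (Rinv_inv (INR (scale 0))). apply Rinv_le_contravar; lra. }
  destruct (scale_bracket (/ r) Hx) as [j Hj].
  pose proof (scale_gt0 j) as H1. pose proof (scale_gt0 (S j)) as H2.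
  set (l := ln (INR (scale j))). set (l' := ln (INR (scale (S j)))). set (h := ln r).
  assert (Hl' : l' <= ln C + w * l).
  { apply Rle_trans with (ln (C * Rpower (INR (scale j)) w)).
    - apply ln_monotone; [lra|apply Hgrow].
    - rewrite ln_mult; [|assumption|apply exp_pos]. rewrite ln_Rpower. unfold l. lra. }
  assert (Hrr : r * / r = 1) by (apply Rinv_r; lra).
  assert (Er : r = exp h) by (unfold h; rewrite exp_ln; lra).
  (* The two bounds are averaged with weights [1 - s] and [s]; because [s * w = 1 - s], the terms in
     [l] cancel. *)
  assert (Emix : forall t, t <= - l / 2 -> t <= h + l' / 2 -> t <= s * h + s * ln C / 2).
  { intros t Ht1 Ht2.
    assert (s * l' <= s * (ln C + w * l)) by (apply Rmult_le_compat_l; lra).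
    assert ((1 - s) * t <= (1 - s) * (- l / 2)) by (apply Rmult_le_compat_l; lra).
    assert (s * t <= s * (h + l' / 2)) by (apply Rmult_le_compat_l; lra).
    replace (s * (ln C + w * l)) with (s * ln C + (1 - s) * l) in * by (rewrite <- Hsw; ring).
    lra. }
  assert (Hfin : forall i t c, 0 <= c <= 11 * exp (t + ln (INR (scale i)) / 2) ->
     t <= - l / 2 -> t <= h + l' / 2 -> c / INR (width arity i) <=
       11 * exp (S0 / 2 + s * ln C / 2) * Rpower r s).
  { intros i t c Hc Ht1 Ht2. pose proof (inv_width_le i) as HI. fold S0 in HI.
    apply Rle_trans with (11 * exp (t + ln (INR (scale i)) / 2) *
        exp ((S0 - ln (INR (scale i))) / 2)).
    - unfold Rdiv. apply Rmult_le_compat; try lra.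
      apply Rlt_le, Rinv_0_lt_compat, width_gt0.
    - unfold Rpower. fold h. rewrite !Rmult_assoc, <- !exp_plus.
      apply Rmult_le_compat_l; [lra|]. apply exp_monotone.
      specialize (Emix t Ht1 Ht2). lra. }
  destruct (Rle_dec (- l / 2) (h + l' / 2)) as [H|H].
  - exists j. apply (Hfin j (- l / 2)); [|lra|lra]. split; [apply pos_INR|].
    apply Rle_trans with (1 := hits_le U r j ltac:(lra) HU). fold l.
    replace (- l / 2 + l / 2) with 0 by lra. rewrite exp_0. nra.
  - exists (S j). apply (Hfin (S j) (h + l' / 2)); [|lra|lra]. split; [apply pos_INR|].
    apply Rle_trans with (1 := hits_le U r (S j) ltac:(lra) HU). fold l'.
    replace (h + l' / 2 + l' / 2) with (h + l') by lra. rewrite exp_plus, <- Er.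
    unfold l'. rewrite exp_ln by lra. nra.
Qed.

(** A cover of small total size marks at most half of the tree in total. Some branch then avoids
    every marked node, and its limit point lies in [U1] but in no set of the cover. *)
Lemma U1_not_null (w C : R) : 0 < w -> 0 < C ->
  (forall j, INR (scale (S j)) <= C * Rpower (INR (scale j)) w) ->
  ~ H_null (/ (w + 1)) (U1 theta).
Proof.
  intros Hw HC Hgrow Hnull.
  destruct (mass_bound w C Hw HC Hgrow) as (K & HK & Hmass).
  pose proof (scale_gt0 0) as HL0.
  destruct (Hnull (/ INR (scale 0)) (/ (2 * K))) as (U & r & Hr & Hdiam & Hcov & Hsum).
  { apply Rinv_0_lt_compat; lra. }
  { apply Rinv_0_lt_compat; lra. }
  assert (HJ : forall i, exists j,
    INR (hits arity offset (meets (U i) j) j 0 1) / INR (width arity j)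
      <= K * Rpower (r i) (/ (w + 1))).
  { intros i. apply Hmass; [split; apply Hr|apply Hdiam]. }
  set (J := fun i => proj1_sig (constructive_indefinite_description _ (HJ i))).
  assert (HJ' : forall i,
    INR (hits arity offset (meets (U i) (J i)) (J i) 0 1) / INR (width arity (J i))
      <= K * Rpower (r i) (/ (w + 1))).
  { intros i. exact (proj2_sig (constructive_indefinite_description _ (HJ i))). }
  destruct (avoiding_branch arity offset (fun i => meets (U i) (J i)) J 1 (1 / 2))
    as (node & digit & H0 & Hnode & Havoid).
  - intros j. unfold arity, nchild. destruct (single _); lia.
  - lra.
  - intros N. apply Rle_trans with (sum_f_R0 (fun i => Rpower (r i) (/ (w + 1)) * K) N).
    + apply sum_Rle. intros i _. rewrite Rmult_comm. apply HJ'.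
    + rewrite <- scal_sum. specialize (Hsum N).
      apply Rle_trans with (K * / (2 * K)); [apply Rmult_le_compat_l; lra|].
      apply Req_le. field. lra.
  - destruct (limit_point node digit Hnode) as (y & p & Hy & Hp & Hcyl).
    destruct (Hcov y) as [i Hi].
    { now apply (branch_in_U1 node digit y p). }
    specialize (Havoid i). unfold meets in Havoid.
    destruct (excluded_middle_informative _) as [|Hno]; [discriminate|].
    apply Hno. exists y, (p (J i)). auto.
Qed.

End Cantor.

End ContinuedFraction.

(** * Hausdorff dimension *)

(** Supplies one null exponent, so that the infimum defining the dimension exists. Exponent 2 leaves
    room: [M] cells of length [1 / M] contribute only [1 / M]. *)
Lemma H_null_2 (E : R -> Prop) : (forall x, E x -> 0 <= x < 1) -> H_null 2 E.
Proof.
  intros HE delta eps Hd He.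
  destruct (INR_unbounded (/ delta + 2 / eps + 1)) as [M HM].
  assert (D1 : 0 < / delta) by (apply Rinv_0_lt_compat; lra).
  assert (D2 : 0 < 2 / eps) by (apply Rdiv_lt_0_compat; lra).
  set (m := / INR M).
  assert (Hm : 0 < m) by (apply Rinv_0_lt_compat; lra).
  assert (HmM : m * INR M = 1) by (unfold m; apply Rinv_l; lra).
  assert (Hmd : m <= delta).
  { unfold m. rewrite <- (Rinv_inv delta). apply Rinv_le_contravar; lra. }
  assert (Hme : 2 * m <= eps).
  { assert (E2 : 2 / eps * eps = 2) by (field; lra).
    assert (2 / eps * eps <= INR M * eps) by (apply Rmult_le_compat_r; lra). nra. }
  assert (Hm1 : m <= 1) by nra.
  (* Sets with index at least [M] are empty but still need positive radii, so these decay
     geometrically. *)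
  set (r := fun i => if lt_dec i M then m else m * (1 / 2) ^ S i).
  assert (Hhalf : forall i, 0 < (1 / 2) ^ i <= 1).
  { induction i as [|i IH]; simpl; lra. }
  assert (Hr : forall i, 0 < r i <= m).
  { intros i. unfold r. specialize (Hhalf (S i)). destruct (lt_dec i M); nra. }
  exists (fun i x => (i < M)%nat /\ m * INR i <= x <= m * (INR i + 1)), r.
  repeat split.
  - apply Hr.
  - apply Rle_trans with (2 := Hmd). apply Hr.
  - intros i x y [Hi Hx] [_ Hy]. unfold r. destruct (lt_dec i M); [|contradiction].
    apply Rle_trans with (1 := distZ_le _ 0).
    unfold Rabs. destruct (Rcase_abs _); lra.
  - intros x Hx. specialize (HE x Hx).
    destruct (base_Int_part (x * INR M)) as [I1 I2].
    set (z := Int_part (x * INR M)) in *.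
    assert (Hz : (-1 < z)%Z).
    { apply lt_IZR. assert (0 <= x * INR M) by (apply Rmult_le_pos; lra). lra. }
    assert (Ez : INR (Z.to_nat z) = IZR z) by (rewrite INR_IZR_INZ, Z2Nat.id by lia; reflexivity).
    exists (Z.to_nat z). rewrite Ez. split.
    + apply INR_lt. rewrite Ez. nra.
    + assert (Ex : x = m * (x * INR M)) by (rewrite (Rmult_comm x), <- Rmult_assoc, HmM; ring).
      set (t := x * INR M) in *. clearbody t. rewrite Ex. split; apply Rmult_le_compat_l; lra.
  - intros N. apply Rle_trans with (2 := Hme).
    assert (G : sum_f_R0 (fun i => Rpower (r i) 2) N
                <= m * m * INR (min (S N) M) + m * (1 - (1 / 2) ^ S N)).
    { assert (Hsq : forall i, Rpower (r i) 2 = r i * r i).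
      { intros i. change 2 with (INR 2). rewrite Rpower_pow by apply Hr. ring. }
      assert (T : forall i, Rpower (r i) 2 <=
         m * m * (INR (min (S i) M) - INR (min i M)) + m * ((1 / 2) ^ i - (1 / 2) ^ S i)).
      { intros i. rewrite Hsq. unfold r. destruct (lt_dec i M) as [H|H].
        - rewrite !Nat.min_l by lia. rewrite S_INR. simpl pow. specialize (Hhalf i). nra.
        - rewrite !Nat.min_r by lia. specialize (Hhalf i). simpl pow.
          set (h := (1 / 2) ^ i) in *. clearbody h.
          assert (m * m <= m) by nra. assert (h * h <= h) by nra.
          assert (m * m * (h * h) <= m * h) by nra. nra. }
      induction N as [|N IH].
      - simpl sum_f_R0. specialize (T 0%nat). simpl INR in *. simpl pow in *. lra.
      - simpl sum_f_R0. specialize (T (S N)). lra. }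
    assert (INR (min (S N) M) <= INR M) by (apply le_INR; lia).
    specialize (Hhalf (S N)).
    assert (m * m * INR (min (S N) M) <= m * m * INR M) by (apply Rmult_le_compat_l; nra).
    nra.
Qed.

(** The infimum of the null exponents is obtained as the supremum of their lower bounds. *)
Lemma hausdorff_dim_exists (E : R -> Prop) : (exists s, s > 0 /\ H_null s E) ->
  exists d, is_hausdorff_dim E d.
Proof.
  intros (s0 & Hs0 & Hn0).
  destruct (completeness (fun d => forall s, s > 0 -> H_null s E -> d <= s)) as [d [Hub Hlub]].
  - exists s0. intros d Hd. now apply Hd.
  - exists 0. intros s Hs _. lra.
  - exists d. split; [|exact Hub].
    intros s Hs Hn. apply Hlub. intros d' Hd'. now apply Hd'.
Qed.

Theorem mainTheorem6 (theta : R) :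
  0 < theta < 1 ->
  (forall p q : Z, q <> 0%Z -> theta <> IZR p / IZR q) ->
  exists d : R, is_hausdorff_dim (U1 theta) d /\
    (forall w : R, is_lub (w_set theta) w -> 1 / (w + 1) <= d).
Proof.
  intros Hth Hirr.
  destruct (hausdorff_dim_exists (U1 theta)) as [d Hd].
  { exists 2. split; [lra|]. apply H_null_2. now intros x []. }
  exists d. split; [assumption|]. intros w [Hub Hlub].
  (* If [w_set] were empty, [w - 1] would be a smaller upper bound. *)
  assert (Hw : 0 < w).
  { destruct (classic (exists s, w_set theta s)) as [(s & Hs)|Hno].
    - specialize (Hub s Hs). destruct Hs. lra.
    - exfalso. assert (w <= w - 1); [|lra]. apply Hlub. intros s Hs. exfalso. eauto. }
  apply (proj2 Hd). intros s Hs Hnull. apply Rnot_lt_le. intros Hlt.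
  (* Chosen so that [s = 1 / (w' + 1)]; since [w' > w], the liminf condition fails for [w']. *)
  set (w' := / s - 1).
  assert (Hw' : w < w').
  { unfold Rdiv in Hlt. rewrite Rmult_1_l in Hlt.
    apply Rinv_0_lt_contravar in Hlt; [|assumption]. rewrite Rinv_inv in Hlt.
    unfold w'. lra. }
  assert (Hnot : ~ liminf_zero theta w').
  { intros H. assert (w' <= w); [|lra]. apply Hub. split; [lra|exact H]. }
  apply not_all_ex_not in Hnot. destruct Hnot as [eps Hnot].
  apply imply_to_and in Hnot. destruct Hnot as [Heps Hnot].
  apply not_all_ex_not in Hnot. destruct Hnot as [N Hnot].
  assert (Hlow : forall j, (N <= j)%nat -> (1 <= j)%nat ->
             eps <= Rpower (INR j) w' * distZ (INR j * theta)).
  { intros j H1 H2. apply Rnot_lt_le. intros H. apply Hnot. now exists j. }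
  (* Starting this late puts all scales beyond [N]; of two consecutive positions, one starts no odd
     block. *)
  assert (Hk : exists k0, (N + 2 <= k0)%nat /\ ~ odd_run theta k0).
  { destruct (classic (odd_run theta (N + 2))) as [H|H].
    - exists (S (N + 2)). split; [lia|now apply odd_run_S].
    - exists (N + 2)%nat. auto. }
  destruct Hk as (k0 & Hk0 & Hrun).
  assert (Es : s = / (w' + 1)) by (unfold w'; field; lra).
  rewrite Es in Hnull. revert Hnull.
  (* In [2 / eps], the 2 comes from [next_denom_le]. The rest follows from
     [eps <= q^w' * delta (S k)] and [L' * delta (S k) <= 1], where [q] and [L'] are consecutive
     denominators. *)
  apply (U1_not_null theta Hth Hirr k0 ltac:(lia) Hrun w' (2 / eps)).
  - lra.
  - apply Rdiv_lt_0_compat; lra.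
  - intros j. pose proof (scale_ge theta Hth Hirr k0 ltac:(lia) j) as Hge.
    pose proof (pos_not_odd_run theta Hth Hirr k0 Hrun j) as Ho.
    specialize (Hlow (scale theta k0 j) ltac:(lia) ltac:(lia)).
    pose proof (next_denom_le theta Hth Hirr _ Ho) as H2.
    fold (scale theta k0 (S j)) in H2.
    change (denom theta (S (next theta (pos theta k0 j)))) with (scale theta k0 (S j)) in H2.
    apply le_INR in H2. rewrite mult_INR in H2. change (INR 2) with 2 in H2.
    apply Rle_trans with (1 := H2).
    unfold scale in Hlow |- *. set (k := pos theta k0 j) in *.
    pose proof (denom_theta theta Hth Hirr k) as Et.
    pose proof (delta_pos theta Hth Hirr (S k)) as D1.
    pose proof (delta_pos theta Hth Hirr (S (S k))) as D2.
    pose proof (denom_delta theta (S k)) as Ed.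
    assert (Hdz : distZ (INR (denom theta (S k)) * theta) <= delta theta (S k)).
    { apply Rle_trans with (1 := distZ_le _ (numer theta (S k))). rewrite Et.
      replace (IZR (numer theta (S k)) + (-1) ^ k * delta theta (S k) - IZR (numer theta (S k)))
        with ((-1) ^ k * delta theta (S k)) by ring.
      rewrite Rabs_mult, pow_1_abs, Rabs_pos_eq; lra. }
    set (R0 := Rpower (INR (denom theta (S k))) w') in *.
    assert (HR0 : 0 < R0) by apply exp_pos.
    set (L' := INR (denom theta (S (S k)))) in *.
    pose proof (pos_INR (denom theta (S k))) as HP.
    assert (HL' : 0 <= L') by apply pos_INR.
    assert (HLd : L' * delta theta (S k) <= 1) by nra.
    assert (eps <= R0 * delta theta (S k)) by nra.
    assert (L' * eps <= R0) by nra.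
    apply Rmult_le_reg_r with eps; [assumption|].
    replace (2 / eps * R0 * eps) with (2 * R0) by (field; lra). lra.
Qed.
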